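(* There exists a universal constant $C<\infty$ such that the following holds. Suppose $y_0:\mathbb{R}\to\mathbb{R}$ is a locally Lipschitz function in $L^p(\mathbb{R})$ for some $p>1$. Then the unique Ecker-Huisken solution $y:\mathbb{R}\times[0,\infty)\to\mathbb{R}$ of $y_t=\frac{y_{xx}}{1+y_x^2}$ starting with $y_0$ satisfies $$|y(x,t)|\leq C\,t^{-\frac{1}{p-1}}\,\|y_0\|_{L^p(\mathbb{R})}^{\frac{p}{p-1}}$$ for all $x\in\mathbb{R}$ and all $0<t<\|y_0\|_{L^p(\mathbb{R})}^{\frac{2p}{p+1}}$.
   Context: Graphical curve shortening flow is the equation $y_t=\frac{y_{xx}}{1+y_x^2}=(\arctan y_x)_x$. For every locally Lipschitz $y_0:\mathbb{R}\to\mathbb{R}$ there is (Ecker-Huisken existence, Chou-Zhu uniqueness) a unique continuous function $y:\mathbb{R}\times[0,\infty)\to\mathbb{R}$ that is smooth and solves this equation on $\mathbb{R}\times(0,\infty)$, with $y(\cdot,0)=y_0$ and $y(\cdot,t)\to y_0$ locally uniformly as $t\downarrow 0$. It is called the Ecker-Huisken solution starting with $y_0$. *)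

(* Defs.v *)
From mathcomp Require Import all_boot all_order all_algebra.
From mathcomp Require Import all_classical all_reals all_analysis.
Set Implicit Arguments.
Unset Strict Implicit.
Unset Printing Implicit Defensive.
Import Order.TTheory GRing.Theory Num.Theory.
Import numFieldNormedType.Exports.
Local Open Scope classical_set_scope.
Local Open Scope ring_scope.

Section SpaceTime.
Variable R : realType.
Implicit Types (f y : R -> R -> R) (w : seq bool) (D : set (R * R)).

(* A function of space and time is written y x t. *)
Definition partial_x f : R -> R -> R := fun x t => derive1 (f ^~ t) x.
Definition partial_t f : R -> R -> R := fun x t => derive1 (f x) t.

(* The iterated mixed partial derivative of f coded by a word w: the letter
   true is d/dx, false is d/dt, and the head of w is the last one applied. *)
Definition iter_partial w f : R -> R -> R :=
  foldr (fun b g => if b then partial_x g else partial_t g) f w.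

(* C^oo on D, for D open: since derive1 is total (with a junk value where the
   limit does not exist), derivability is required at every order. *)
Definition smooth_on D f : Prop :=
  forall w (x t : R), D (x, t) ->
    [/\ derivable ((iter_partial w f) ^~ t) x 1,
        derivable (iter_partial w f x) t 1 &
        {for (x, t), continuous (fun p : R * R => iter_partial w f p.1 p.2)}].

(* The library's phrasing localizes at every point (a, b) of R x R, not only on
   the diagonal; off the diagonal it amounts to local boundedness, so this is
   equivalent to: every a has a neighbourhood on which u is Lipschitz. *)
Definition locally_lipschitz (u : R -> R) : Prop :=
  [locally [lipschitz u x | x in setT]].

(* y represents a function on R x [0, +oo[: its values at negative times are
   arbitrary and are not constrained by any of the clauses. *)
Record is_ecker_huisken_solution (y0 : R -> R) y : Prop := {
  eh_continuous :
    {within [set p : R * R | 0 <= p.2], continuous (fun p => y p.1 p.2)} ;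
  eh_smooth : smooth_on [set p : R * R | 0 < p.2] y ;
  eh_equation : forall x t : R, 0 < t ->
    partial_t y x t =
      partial_x (partial_x y) x t / (1 + (partial_x y x t) ^+ 2) ;
  eh_initial : forall x : R, y x 0 = y0 x ;
  eh_locally_uniform :
    {family compact, (fun t : R => y ^~ t) @ 0^'+ --> y0}
}.

Definition lebesgue_Lp_norm (p : R) (u : R -> R) : R :=
  fine ('N[@lebesgue_measure R]_(p%:E) [EFin \o u])%E.

End SpaceTime.

(* Main.v *)
Require Import Defs.
From mathcomp Require Import all_boot all_order all_algebra.
From mathcomp Require Import all_classical all_reals all_analysis.
From mathcomp Require Import measurable_realfun ring lra.
Import Order.TTheory GRing.Theory Num.Theory.
Import numFieldNormedType.Exports.
Local Open Scope classical_set_scope.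
Local Open Scope ring_scope.
Set Implicit Arguments.
Unset Strict Implicit.
Unset Printing Implicit Defensive.

(* Let h = t^(-1/(p-1)) N^(p/(p-1)) with N the L^p norm of y_0. Since
   y_0 - h <= h^(1-p) |y_0|^p, the area of y_0 above height h is at most
   h^(1-p) N^p = t, and the restriction on t says exactly sqrt t <= h. So it
   is enough to show that v = y - h satisfies v(., t) <= 8 sqrt t as soon as
   every integral of v(., 0) over a segment is at most t.
   For this, double the variables in the potential: for z <= x let
   D(x, z, s) be the integral of v(., s) over [z, x]. Then
   D_s = arctan v_x(x) - arctan v_x(z), so D <= t + pi s with no assumption
   at infinity. This crude bound places D below an explicit quadratic barrier
   on the boundary of a triangle of size sqrt t around a given point. The
   barrier decreases in time at rate 1 and has second derivative -3/2 in x
   and in z; at a positive maximum of D minus the barrier one would have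
   v_x(x) <= -3/2 and v_x(z) >= 3/2, hence D_s < -pi/2 <= -1, which is absurd.
   At time t the barrier vanishes on the diagonal x = z, with slope 8 sqrt t
   at the given point, whence the bound on v. *)

(** * Derivative tests at a maximum *)

Lemma derive_gt0_lt (R : realType) (f : R -> R) (c m : R) :
  is_derive c 1 f m -> 0 < m ->
  exists2 d, 0 < d &
    forall e, 0 < e -> e < d -> f (c - e) < f c /\ f c < f (c + e).
Proof.
move=> [df fm] m0.
have q : h^-1 *: (f (h + c) - f c) @[h --> 0^'] --> m.
  have E : (fun h => h^-1 *: ((f \o shift c) (h *: 1) - f c)) =
           (fun h => h^-1 *: (f (h + c) - f c)).
    by apply/funext => h; rewrite /= [h *: 1]mulr1.
  by move: df; rewrite -fm /derivable /derive E.
have /= [d /= d0 hd] := cvgr_gt _ q _ m0.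
exists d => // e e0 ed.
have en : `|e| < d by rewrite gtr0_norm.
split.
- have := hd (- e); rewrite /= sub0r opprK en oppr_eq0 gt_eqF// => /(_ isT isT).
  rewrite /GRing.scale/= invrN mulNr -mulrN pmulr_rgt0 ?invr_gt0//.
  by rewrite opprB subr_gt0 addrC.
- have := hd e; rewrite /= sub0r normrN en gt_eqF// => /(_ isT isT).
  by rewrite /GRing.scale/= pmulr_rgt0 ?invr_gt0// subr_gt0 addrC.
Qed.

(** If [m > 0], then, since [df c = 0], [df] is positive just to the right of [c], and the mean
    value theorem makes [f] exceed [f c] there. *)
Lemma derive2_at_max (R : realType) (f df : R -> R) (a b c m : R) :
  (forall x, x \in `]a, b[ -> is_derive x 1 f (df x)) ->
  c \in `]a, b[ -> (forall x, x \in `]a, b[ -> f x <= f c) ->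
  is_derive c 1 df m -> m <= 0.
Proof.
move=> fdf cab fc dm; rewrite leNgt; apply/negP => m0.
have /andP[ac cb] : a < c < b by move: cab; rewrite in_itv.
have dfc : df c = 0.
  have ab := lt_trans ac cb.
  have [] := derive1_at_max (ltW ab) _ cab fc.
    by move=> x /fdf [].
  by have [_ ->] := fdf _ cab.
have [e e0 he] := derive_gt0_lt dm m0.
pose d := Num.min (e / 2) ((b - c) / 2).
have d0 : 0 < d by rewrite lt_min !divr_gt0 ?subr_gt0.
have de : d < e by rewrite gt_min; apply/orP; left; lra.
have db : c + d < b by rewrite -ltrBrDl gt_min; apply/orP; right; lra.
have cd : c < c + d by rewrite ltrDl.
have sub x : c <= x <= c + d -> x \in `]a, b[.
  by move=> /andP[? ?]; rewrite in_itv/=; apply/andP; split; lra.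
have fd x : x \in `]c, c + d[ -> is_derive x 1 f (df x).
  by rewrite in_itv/= => /andP[? ?]; apply/fdf/sub/andP; split; lra.
have cf : {within `[c, c + d], continuous f}.
  apply: derivable_within_continuous => x; rewrite in_itv/= => xcd.
  by have [] := fdf _ (sub _ xcd).
have [x] := MVT cd fd cf.
rewrite in_itv/= => /andP[cx xd] fE.
have : f (c + d) <= f c by apply/fc/sub/andP; split; lra.
rewrite -subr_le0 fE leNgt mulr_gt0//; last by lra.
have := he (x - c); rewrite subr_gt0 => /(_ cx).
have -> : x - c < e by lra.
by move=> /(_ isT)[_]; rewrite dfc (addrC c) subrK.
Qed.

(** * Continuity, bounds and integrability in two variables *)

Lemma continuous_comp2 (R : realType) (T : topologicalType)
    (g : R -> R -> R) (f1 f2 : T -> R) (p : T) :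
  {for p, continuous f1} -> {for p, continuous f2} ->
  {for (f1 p, f2 p), continuous (fun q : R * R => g q.1 q.2)} ->
  {for p, continuous (fun q => g (f1 q) (f2 q))}.
Proof.
move=> c1 c2 cg; apply: (@continuous_comp _ _ _ (fun q => (f1 q, f2 q))
  (fun q : R * R => g q.1 q.2) p) => //.
exact: (cvg_pair c1 c2).
Qed.

Lemma continuous_slice1 (R : realType) (f : R -> R -> R) (x t : R) :
  {for (x, t), continuous (fun p : R * R => f p.1 p.2)} ->
  {for x, continuous (f ^~ t)}.
Proof. exact: (continuous_comp2 (f1 := idfun) cvg_id (cvg_cst t)). Qed.

Lemma continuous_slice2 (R : realType) (f : R -> R -> R) (x t : R) :
  {for (x, t), continuous (fun p : R * R => f p.1 p.2)} ->
  {for t, continuous (f x)}.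
Proof. exact: (continuous_comp2 (f2 := idfun) (cvg_cst x) cvg_id). Qed.

Lemma bounded_rectangle (R : realType) (f : R -> R -> R) (a b c d : R) :
  (forall x t, a <= x <= b -> c <= t <= d ->
    {for (x, t), continuous (fun p : R * R => f p.1 p.2)}) ->
  exists2 M, 0 <= M & forall x t, a <= x <= b -> c <= t <= d -> `|f x t| <= M.
Proof.
move=> cf; pose K := `[a, b]%classic `*` `[c, d]%classic : set (R * R).
have cK : compact K by apply: compact_setX; exact: segment_compact.
have wf : {within K, continuous (fun p : R * R => f p.1 p.2)}.
  apply: continuous_in_subspaceT => -[x t] /set_mem[/=].
  by rewrite !in_itv; exact: cf.
have /ex_strict_bound_gt0[M M0 fM] := compact_bounded (continuous_compact wf cK).
exists M; first exact: ltW M0.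
move=> x t xab tcd; apply/ltW/fM; exists (x, t) => //.
Qed.

Lemma integrable_slice (R : realType) (f : R -> R) (a b : R) :
  (forall x, a <= x <= b -> {for x, continuous f}) ->
  (@lebesgue_measure R).-integrable `[a, b] (EFin \o f).
Proof.
move=> cf; apply: continuous_compact_integrable; first exact: segment_compact.
by apply: continuous_in_subspaceT => x /set_mem/=; rewrite in_itv; exact: cf.
Qed.

(** * The potential and its joint continuity *)

Section primitive.
Context {R : realType}.
Notation mu := (@lebesgue_measure R).
Implicit Types (f : R -> R -> R) (a b x t : R).

Definition primitive f a x t : R := \int[mu]_(s in `[a, x]) f s t.

Lemma primitive_derive1 f a x t : continuous (fun p : R * R => f p.1 p.2) ->
  a < x -> is_derive x 1 (fun z => primitive f a z t) (f x t).
Proof.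
move=> cf ax.
have xx1 : x < x + 1 by rewrite ltrDl.
have fi : mu.-integrable `[a, x + 1] (EFin \o f ^~ t).
  by apply: integrable_slice => y _; exact/continuous_slice1/cf.
have /= [d dE] := continuous_FTC1_closed xx1 fi ax (continuous_slice1 (cf _)).
by apply: (DeriveDef d); rewrite -derive1E dE.
Qed.

Lemma continuous_primitive f a x t : continuous (fun p : R * R => f p.1 p.2) ->
  a < x -> {for (x, t), continuous (fun p : R * R => primitive f a p.1 p.2)}.
Proof.
move=> cf ax; pose b := x + 1.
pose g s r := `|f s r - f s t|.
have cg : continuous (fun p : R * R => g p.1 p.2).
  move=> p; apply: cvg_norm; apply: cvgB; first exact: cf.
  exact: (continuous_comp2 cvg_fst (cvg_cst t) (cf _)).
have [M M0 gM] : exists2 M, 0 <= M &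
    forall s r, a <= s <= b -> t - 1 <= r <= t + 1 -> `|g s r| <= M.
  by apply: bounded_rectangle => s r _ _; exact: cg.
pose G r := \int[mu]_(s in `[a, b]) g s r.
have ig r : mu.-integrable `[a, b] (EFin \o g ^~ r).
  by apply: integrable_slice => s _; exact/continuous_slice1/cg.
have cG : {for t, continuous G}.
  apply: (@continuity_under_integral R _ _ mu (fun r s => g s r) `[a, b] _
    (t - 1) (t + 1) _ _ (cst M)) => //.
  - apply: aeW => s _ r _; exact/continuous_slice2/cg.
  - by apply: integrable_slice => s _; exact: cvg_cst.
  - move=> r; rewrite /= in_itv/= => /andP[? ?]; apply: aeW => s.
    by rewrite /= in_itv/= => sab; apply: gM => //; apply/andP; split; exact: ltW.
  - by apply/mem_set; rewrite /= in_itv/= ltrDl gtrBl ltr01.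
have G0 : G t = 0.
  rewrite /G; under eq_Rintegral do rewrite /g subrr normr0.
  by rewrite Rintegral_cst// mul0r.
have cP : {for x, continuous (fun z => primitive f a z t)}.
  apply/differentiable_continuous/derivable1_diffP.
  by have [] := primitive_derive1 t cf ax.
apply/cvgrPdist_lt => e e0.
have e20 : 0 < e / 2 by rewrite divr_gt0.
have n1 : \forall p \near ((x, t) : R * R),
    `|primitive f a x t - primitive f a p.1 t| < e / 2.
  exact: (@cvg_fst _ _ (nbhs x) (nbhs t) _ _ (proj1 (cvgrPdist_lt _ _) cP _ e20)).
have n2 : \forall p \near ((x, t) : R * R), `|G t - G p.2| < e / 2.
  exact: (@cvg_snd _ _ (nbhs x) (nbhs t) _ _ (proj1 (cvgrPdist_lt _ _) cG _ e20)).
have n3 : \forall p \near ((x, t) : R * R), p.1 < b.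
  have xb : x < b by rewrite ltrDl.
  exact: (@cvg_fst _ _ (nbhs x) (nbhs t) _ _ (lt_nbhsl xb)).
near=> p.
have h1 : `|primitive f a x t - primitive f a p.1 t| < e / 2 by near: p.
have h2 : `|G t - G p.2| < e / 2 by near: p.
have pb : p.1 < b by near: p.
have h3 : `|primitive f a p.1 t - primitive f a p.1 p.2| <= G p.2.
  have is_ r : mu.-integrable `[a, p.1] (EFin \o f ^~ r).
    by apply: integrable_slice => s _; exact/continuous_slice1/cf.
  have sab : `[a, p.1]%classic `<=` `[a, b]%classic.
    by apply: subset_itvl; rewrite bnd_simp ltW.
  rewrite /primitive distrC -RintegralB//.
  apply: (le_trans (le_normr_Rintegral _ _)) => //.
    by have := integrableB _ (is_ p.2) (is_ t); apply.
  rewrite /G /Rintegral fine_le//.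
  - apply: integrable_fin_num => //; apply: integrableS (ig p.2) => //.
  - by apply: integrable_fin_num => //; exact: ig.
  - apply: ge0_subset_integral => //.
    by have /integrableP[] := ig p.2.
move: h2; rewrite G0 sub0r normrN => h2.
have := le_lt_trans h3 (le_lt_trans (ler_norm _) h2).
have := ler_distD (primitive f a p.1 t) (primitive f a x t) (primitive f a p.1 p.2).
by lra.
Unshelve. all: by end_near. Qed.

End primitive.

(* Only the divergence form [v_t = (arctan v_x)_x] is retained, so no second
   derivative of [v] is ever mentioned; all values at times [t <= 0] serve
   only to make [v] continuous on the whole plane. *)
Record divergence_flow (R : realType) (v vx vt : R -> R -> R) : Prop := {
  flow_cont : continuous (fun p : R * R => v p.1 p.2) ;
  flow_dx : forall x t : R, 0 < t -> is_derive x 1 (v ^~ t) (vx x t) ;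
  flow_dt : forall x t : R, 0 < t -> is_derive t 1 (v x) (vt x t) ;
  flow_flux : forall x t : R, 0 < t ->
    is_derive x 1 (fun s => atan (vx s t)) (vt x t) ;
  flow_dt_cont : forall x t : R, 0 < t ->
    {for (x, t), continuous (fun p : R * R => vt p.1 p.2)}
}.

(** * Time derivative of the potential *)

Lemma is_derive_continuous (R : realType) (f : R -> R) (x d : R) :
  is_derive x 1 f d -> {for x, continuous f}.
Proof. by case=> df _; exact/differentiable_continuous/derivable1_diffP. Qed.

(** Differentiation under the integral gives the integral of [vt], which is the space derivative of
    the flux [atan (vx s t)]; the fundamental theorem leaves the two end values. *)
Lemma primitive_derive2 (R : realType) (v vx vt : R -> R -> R) (a x t : R) :
  divergence_flow v vx vt -> a < x -> 0 < t ->
  is_derive t 1 (primitive v a x) (atan (vx x t) - atan (vx a t)).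
Proof.
move=> [cv _ dvt flux cvt] ax t0.
(* The window from [t / 2] to [2 * t] stays in positive times, where [vt] is continuous; [M] is the
   dominating constant. *)
have [M M0 vtM] : exists2 M, 0 <= M &
    forall s r, a <= s <= x -> t / 2 <= r <= 2 * t -> `|vt s r| <= M.
  by apply: bounded_rectangle => s r _ /andP[tr _]; apply: cvt; lra.
have dvE s r : 0 < r -> partial1of2 (fun r s => v s r) r s = vt s r.
  by move=> r0; rewrite partial1of2E; have [_ ->] := dvt s r r0.
have It : [set` `]t / 2, 2 * t[] t by rewrite /= in_itv/=; apply/andP; split; lra.
have h1 r : [set` `]t / 2, 2 * t[] r ->
    (@lebesgue_measure R).-integrable `[a, x] (EFin \o (v ^~ r)).
  by move=> _; apply: integrable_slice => s _; exact/continuous_slice1/cv.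
have h2 r s : [set` `]t / 2, 2 * t[] r -> `[a, x]%classic s -> derivable (v s) r 1.
  rewrite /= in_itv/= => /andP[tr _] _.
  have r0 : 0 < r by lra.
  by have [] := dvt s r r0.
have h3 : forall s : R, 0 <= cst M s by [].
have h4 : (@lebesgue_measure R).-integrable `[a, x] (EFin \o cst M).
  by apply: integrable_slice => s _; exact: cvg_cst.
have h5 r s : [set` `]t / 2, 2 * t[] r -> `[a, x]%classic s ->
    `|partial1of2 (fun r s => v s r) r s| <= cst M s.
  rewrite /= !in_itv/= => /andP[tr rt] sax.
  have r0 : 0 < r by lra.
  by rewrite dvE//; apply: vtM => //; apply/andP; split; lra.
have mB : measurable `[a, x]%classic by [].
have := @derivable_under_integral R _ _ lebesgue_measure
  (fun r s => v s r) _ mB t (t / 2) (2 * t) It h1 h2 _ h3 h4 h5.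
have := @differentiation_under_integral R _ _ lebesgue_measure
  (fun r s => v s r) _ mB t (t / 2) (2 * t) It h1 h2 _ h3 h4 h5.
rewrite derive1E => D1 D2; apply: DeriveDef; first exact: D2.
rewrite [LHS]D1; under eq_Rintegral do rewrite dvE//.
have fl s := is_derive_continuous (flux s t t0).
rewrite /Rintegral (@continuous_FTC2 _ (vt ^~ t) (fun s => atan (vx s t)))//.
- apply: continuous_in_subspaceT => s _; apply: continuous_slice1; exact: cvt.
- split; first by move=> s _; have [] := flux s t t0.
  + by apply: cvg_at_right_filter; exact: fl.
  + by apply: cvg_at_left_filter; exact: fl.
- by move=> s _; rewrite derive1E; have [_ ->] := flux s t t0.
Qed.

(** Frozen in all but one variable, the barrier is such a polynomial; [m = 0] covers its derivatives
    and its dependence on time. *)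
Lemma is_derive_quadratic (R : realType) (k l m x : R) :
  is_derive x 1 (fun y : R => k + l * y + m * y ^+ 2) (l + 2 * m * x).
Proof.
have d1 := is_derive_id x (1 : R).
have d2 := is_deriveM d1 d1.
have dq := is_deriveD (is_deriveD (is_derive_cst k x 1) (is_deriveZ l d1))
  (is_deriveZ m d2).
have E : (fun y : R => k + l * y + m * y ^+ 2) =
    cst k + l \*: (@idfun R) + m \*: ((@idfun R) * (@idfun R)).
  by apply/funext => y; rewrite !fctE expr2.
rewrite E; apply: (is_derive_eq dq); rewrite /GRing.scale/=; ring.
Qed.

(** * Doubling of variables and comparison with the barrier *)

Section doubling.
Context {R : realType}.
Implicit Types (v vx vt : R -> R -> R) (a r x z t : R).

(** Mean value theorem in time: the rate is a difference of two arctangents, hence below [pi]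
    however steep the graph is. *)
Lemma primitiveB_growth v vx vt a x z t : divergence_flow v vx vt ->
  a < z -> a < x -> 0 <= t ->
  primitive v a x t - primitive v a z t <=
    primitive v a x 0 - primitive v a z 0 + pi * t.
Proof.
move=> fl az ax; rewrite le_eqVlt => /predU1P[<-|t0].
  by rewrite mulr0 addr0.
have cv := flow_cont fl.
pose D s := primitive v a x s - primitive v a z s.
have dD s : s \in `]0, t[ -> is_derive s 1 D (atan (vx x s) - atan (vx z s)).
  rewrite in_itv/= => /andP[s0 _].
  have dx := primitive_derive2 fl ax s0.
  have dz := primitive_derive2 fl az s0.
  by apply: (is_derive_eq (is_deriveB dx dz)); ring.
have cD : {within `[0, t], continuous D}.
  apply: continuous_in_subspaceT => s _; apply: cvgB.
  - exact/continuous_slice2/continuous_primitive.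
  - exact/continuous_slice2/continuous_primitive.
have [s _] := MVT t0 dD cD.
rewrite -/(D t) -/(D 0) subr0 -lerBlDl => ->.
rewrite ler_pM2r//.
have := atan_ltpi2 (vx x s); have := atan_gtNpi2 (vx z s).
lra.
Qed.

(* In the coordinates [s = x - z] and [m = (x + z) / 2 - x0] this is
   [r ^ 2 - t + 8 r s - s ^ 2 + m ^ 2]; the final time is [t = r ^ 2]. *)
Definition barrier r (x0 : R) x z t : R :=
  r ^+ 2 - t + 8 * r * (x - z) - 3 / 4 * ((x - x0) ^+ 2 + (z - x0) ^+ 2)
  + 5 / 2 * ((x - x0) * (z - x0)).

Lemma continuous_fst_fst (p : R * R * R) :
  {for p, continuous (fun q : R * R * R => q.1.1)}.
Proof. by apply: (@continuous_comp _ _ _ fst fst); exact: cvg_fst. Qed.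

Lemma continuous_fst_snd (p : R * R * R) :
  {for p, continuous (fun q : R * R * R => q.1.2)}.
Proof.
by apply: (@continuous_comp _ _ _ fst snd); [exact: cvg_fst|exact: cvg_snd].
Qed.

Lemma continuous_barrier r x0 :
  continuous (fun p : R * R * R => barrier r x0 p.1.1 p.1.2 p.2).
Proof.
move=> p.
have c1 := continuous_fst_fst (p := p).
have c2 := continuous_fst_snd (p := p).
have c3 : {for p, continuous (fun q : R * R * R => q.2)} by exact: cvg_snd.
have ck (k : R) : {for p, continuous (fun _ : R * R * R => k)} by exact: cvg_cst.
have cx := continuousB c1 (ck x0).
have cz := continuousB c2 (ck x0).
have e1 := continuousD (continuousB (ck (r ^+ 2)) c3)
  (continuousM (ck (8 * r)) (continuousB c1 c2)).
have e2 := continuousM (ck (3 / 4))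
  (continuousD (continuousM cx cx) (continuousM cz cz)).
have e3 := continuousM (ck (5 / 2)) (continuousM cx cz).
exact: (continuousD (continuousB e1 e2) e3).
Qed.

(** A positive maximum of [F] on the compact prism [K] is excluded by size on the initial face, the
    diagonal and the two outer sides, and by the derivatives in [x], [z] and time elsewhere, final
    time included. *)
Lemma primitiveB_le_barrier v vx vt a (x0 : R) r : divergence_flow v vx vt ->
  0 < r -> a < x0 - 3 * r ->
  (forall x z, a < z -> z <= x ->
    primitive v a x 0 - primitive v a z 0 <= r ^+ 2) ->
  forall x z, x0 - 3 * r <= z -> z <= x -> x <= x0 + 3 * r ->
    primitive v a x (r ^+ 2) - primitive v a z (r ^+ 2) <=
      barrier r x0 x z (r ^+ 2).
Proof.
move=> fl r0 ar init x1 z1 rz1 zx1 xr1.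
have cv := flow_cont fl.
pose J := `[x0 - 3 * r, x0 + 3 * r]%classic.
pose K : set (R * R * R) := ((J `*` J) `*` `[0, r ^+ 2]%classic) `&`
  [set p | 0 <= p.1.1 - p.1.2].
pose F (p : R * R * R) := primitive v a p.1.1 p.2 - primitive v a p.1.2 p.2
  - barrier r x0 p.1.1 p.1.2 p.2.
have KP x z t : K (x, z, t) <->
    [/\ x0 - 3 * r <= z, z <= x, x <= x0 + 3 * r, 0 <= t & t <= r ^+ 2].
  rewrite /K /J /= !in_itv/= subr_ge0; split.
    by move=> [[[/andP[? ?] /andP[? ?]] /andP[? ?]] ?].
  by move=> [? ? ? ? ?]; repeat split => //; apply/andP; split => //; lra.
have cK : compact K.
  apply: compact_closedI.
    apply: compact_setX; last exact: segment_compact.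
    by apply: compact_setX; exact: segment_compact.
  apply: (@preimage_closed _ _ (fun p : R * R * R => p.1.1 - p.1.2)
      [set s | 0 <= s]); last exact: closed_ge.
  by move=> p _; apply: cvgB; [exact: continuous_fst_fst|exact: continuous_fst_snd].
have cF : {within K, continuous F}.
  apply: continuous_in_subspaceT => -[[x z] t] /set_mem/KP[rz zx xr _ _].
  have az : a < z by lra.
  have ax : a < x by lra.
  apply: cvgB; last exact: continuous_barrier.
  apply: cvgB.
  - exact: (continuous_comp2 (@continuous_fst_fst (x, z, t)) cvg_snd
      (continuous_primitive cv ax)).
  - exact: (continuous_comp2 (@continuous_fst_snd (x, z, t)) cvg_snd
      (continuous_primitive cv az)).
have r20 : 0 <= r ^+ 2 by exact: sqr_ge0.
have K1 : K (x1, z1, r ^+ 2) by apply/KP; split.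
have [[[x z] t] /set_mem/KP[rz zx xr t0 tr] Fmax] :=
  compact_EVT_max (ex_intro _ _ K1) cK cF.
rewrite -subr_le0; have := Fmax _ (mem_set K1); rewrite /F/= => /le_trans; apply.
rewrite leNgt; apply/negP => Fpos.
have az : a < z by lra.
have ax : a < x by lra.
(* The initial bound contributes [r ^+ 2]; [pi < 4] and [t <= r ^+ 2] contribute the rest. *)
have crude : primitive v a x t - primitive v a z t <= 5 * r ^+ 2.
  apply: le_trans (primitiveB_growth fl az ax t0) _.
  have := init x z az zx; have : pi * t <= 4 * r ^+ 2.
    by apply: ler_pM => //; [exact: pi_ge0|have := @pihalf_lt2 R; lra].
  by lra.
(* At time zero the barrier is [r ^+ 2] plus [(x - z) * (8 * r - (x - z))] plus a square, and
   [x - z <= 6 * r]. *)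
have t_gt0 : 0 < t.
  rewrite lt_neqAle t0 andbT; apply/eqP => t00.
  move: Fpos; rewrite -t00 /barrier.
  have xz8 : 0 <= (x - z) * (8 * r - (x - z)) by apply: mulr_ge0; lra.
  have := init x z az zx; have := sqr_ge0 (x - x0 + (z - x0)); lra.
have zx' : z < x.
  rewrite lt_neqAle zx andbT; apply/eqP => zx0.
  move: Fpos; have := sqr_ge0 (x - x0); rewrite zx0 /barrier; lra.
(* On this side the barrier is at least [9 * r ^+ 2], above the crude bound: the excess is
   [r ^+ 2 - t] plus 3/4 of the first product below and 1/2 of the second. The other side is its
   mirror image. *)
have xr' : x < x0 + 3 * r.
  rewrite lt_neqAle xr andbT; apply/eqP => xr0.
  have zr2 : 0 <= (3 * r - (z - x0)) * (3 * r + (z - x0)).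
    by apply: mulr_ge0; lra.
  have rzr : 0 <= r * (3 * r - (z - x0)) by apply: mulr_ge0; lra.
  move: Fpos; rewrite xr0 in crude *; rewrite /barrier; lra.
have rz' : x0 - 3 * r < z.
  rewrite lt_neqAle rz andbT; apply/eqP => zr0.
  have xr2 : 0 <= (3 * r - (x - x0)) * (3 * r + (x - x0)).
    by apply: mulr_ge0; lra.
  have rxr : 0 <= r * (3 * r + (x - x0)) by apply: mulr_ge0; lra.
  move: Fpos; rewrite -zr0 in crude *; rewrite /barrier; lra.
have vxx : vx x t <= - (3 / 2).
  (* [l] and [k] are the linear and constant coefficients in [x] of what [F] subtracts from the
     first potential; putting 0 for [x] isolates the constant term of the barrier. *)
  pose l := 8 * r + 3 / 2 * x0 + 5 / 2 * (z - x0).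
  pose k := primitive v a z t + barrier r x0 0 z t.
  have dF s : s \in `]z, x0 + 3 * r[ ->
      is_derive s 1 (fun s => F (s, z, t)) (v s t - (l + 2 * - (3 / 4) * s)).
    rewrite in_itv/= => /andP[zs _]; have as_ := lt_trans az zs.
    have -> : (fun s => F (s, z, t)) = (fun s => primitive v a s t) -
        (fun s => k + l * s + - (3 / 4) * s ^+ 2).
      by apply/funext => y; rewrite /F/= !fctE /k /l /barrier; field.
    exact: is_deriveB (primitive_derive1 t cv as_) (is_derive_quadratic _ _ _ _).
  have d2F : is_derive x 1 (fun s => v s t - (l + 2 * - (3 / 4) * s))
      (vx x t + 3 / 2).
    have -> : (fun s => v s t - (l + 2 * - (3 / 4) * s)) = (v ^~ t) +
        (fun s => - l + 3 / 2 * s + 0 * s ^+ 2).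
      by apply/funext => y; rewrite !fctE; field.
    apply: (is_derive_eq (is_deriveD (flow_dx fl x t_gt0)
      (is_derive_quadratic _ _ _ _))).
    by ring.
  rewrite -subr_le0 opprK; apply: (derive2_at_max dF _ _ d2F).
    by rewrite in_itv/= zx'.
  move=> s; rewrite in_itv/= => /andP[zs sr]; apply: Fmax; apply/mem_set/KP.
  by split=> //; exact: ltW.
(* In [z] the potential enters with the opposite sign, which reverses the inequality on the
   slope. *)
have vxz : 3 / 2 <= vx z t.
  pose l := - 8 * r + 3 / 2 * x0 + 5 / 2 * (x - x0).
  pose k := barrier r x0 x 0 t - primitive v a x t.
  have dF s : s \in `]x0 - 3 * r, x[ ->
      is_derive s 1 (fun s => F (x, s, t)) (- v s t - (l + 2 * - (3 / 4) * s)).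
    rewrite in_itv/= => /andP[rs _]; have as_ := lt_trans ar rs.
    have -> : (fun s => F (x, s, t)) = - (fun s => primitive v a s t) -
        (fun s => k + l * s + - (3 / 4) * s ^+ 2).
      by apply/funext => y; rewrite /F/= !fctE /k /l /barrier; field.
    exact: is_deriveB (is_deriveN (primitive_derive1 t cv as_))
      (is_derive_quadratic _ _ _ _).
  have d2F : is_derive z 1 (fun s => - v s t - (l + 2 * - (3 / 4) * s))
      (- vx z t + 3 / 2).
    have -> : (fun s => - v s t - (l + 2 * - (3 / 4) * s)) = - (v ^~ t) +
        (fun s => - l + 3 / 2 * s + 0 * s ^+ 2).
      by apply/funext => y; rewrite !fctE; field.
    apply: (is_derive_eq (is_deriveD (is_deriveN (flow_dx fl z t_gt0))
      (is_derive_quadratic _ _ _ _))).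
    by ring.
  rewrite -subr_le0 addrC; apply: (derive2_at_max dF _ _ d2F).
    by rewrite in_itv/= rz'.
  move=> s; rewrite in_itv/= => /andP[rs sx]; apply: Fmax; apply/mem_set/KP.
  by split=> //; exact: ltW.
have dF : is_derive t 1 (fun s => - F (x, z, s))
    (atan (vx z t) - atan (vx x t) - 1).
  have -> : (fun s => - F (x, z, s)) = primitive v a z - primitive v a x +
      (fun s => barrier r x0 x z 0 + - 1 * s + 0 * s ^+ 2).
    by apply/funext => y; rewrite /F/= !fctE /barrier; field.
  apply: (is_derive_eq (is_deriveD (is_deriveB (primitive_derive2 fl az t_gt0)
    (primitive_derive2 fl ax t_gt0)) (is_derive_quadratic _ _ _ _))).
  by ring.
(* Both slopes exceed 1 in absolute value, with opposite signs, so the arctangents differ by more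
   than [pi / 2 >= 1]. *)
have dFpos : 0 < atan (vx z t) - atan (vx x t) - 1.
  have : pi / 4 < atan (vx z t) by rewrite -atan1; apply: lt_atan; lra.
  have : atan (vx x t) < - (pi / 4) by rewrite -atan1 -atanN; apply: lt_atan; lra.
  by have := @pihalf_ge1 R; lra.
have [d d0 hd] := derive_gt0_lt dF dFpos.
(* Stepping back in time by [e] stays in [K], even from the final time, and increases [F]. *)
pose e := Num.min (d / 2) (t / 2).
have e0 : 0 < e by rewrite lt_min !divr_gt0.
have ed : e < d by rewrite gt_min; apply/orP; left; lra.
have et : e < t by rewrite gt_min; apply/orP; right; lra.
have [+ _] := hd e e0 ed.
rewrite ltrN2 ltNge => /negP[]; apply: Fmax; apply/mem_set/KP.
by split => //; lra.
Qed.

End doubling.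

(** * From the potential to a pointwise bound *)

(** With the barrier centred at [x], the potential grows from [x] to [x + e] by at most
    [8 * r * e - 3 / 4 * e ^+ 2], so its derivative at [x], which is [v], cannot exceed [8 * r]. *)
Lemma flow_le (R : realType) (v vx vt : R -> R -> R) (r x : R) :
  divergence_flow v vx vt -> 0 < r ->
  (forall z y, z <= y ->
    \int[lebesgue_measure]_(s in `[z, y]) v s 0 <= r ^+ 2) ->
  v x (r ^+ 2) <= 8 * r.
Proof.
move=> fl r0 init; have cv := flow_cont fl.
have isl (b c : R) : (@lebesgue_measure R).-integrable `[b, c] (EFin \o v ^~ 0).
  by apply: integrable_slice => s _; exact/continuous_slice1/cv.
pose a := x - 3 * r - 1.
have ar : a < x - 3 * r by rewrite ltrBlDr ltrDl.
have ax : a < x by lra.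
have init' y z : a < z -> z <= y ->
    primitive v a y 0 - primitive v a z 0 <= r ^+ 2.
  move=> az zy; rewrite /primitive Rintegral_itvB//; last first.
    by rewrite bnd_simp ltW.
  rewrite Rintegral_itv_obnd_cbnd; first exact: init.
  by apply: integrableS (isl z y) => //; exact: subset_itv_oc_cc.
have B := primitiveB_le_barrier fl r0 ar init'.
rewrite leNgt; apply/negP => vr.
pose f y := primitive v a y (r ^+ 2).
have dg : is_derive x 1 (f - (fun y => 0 + 8 * r * y + 0 * y ^+ 2))
    (v x (r ^+ 2) - 8 * r).
  apply: (is_derive_eq (is_deriveB (primitive_derive1 _ cv ax)
    (is_derive_quadratic _ _ _ _))).
  by ring.
have [d d0 hd] := derive_gt0_lt dg ltac:(by rewrite subr_gt0).
pose e := Num.min (d / 2) r.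
have e0 : 0 < e by rewrite lt_min divr_gt0.
have ed : e < d by rewrite gt_min; apply/orP; left; lra.
have er : e <= r by rewrite ge_min lexx orbT.
have [_ hf] := hd e e0 ed.
have := B (x + e) x ltac:(lra) ltac:(lra) ltac:(lra).
rewrite -/(f _) -/(f _) /barrier.
by have := sqr_ge0 e; move: hf; rewrite !fctE; lra.
Qed.

(** * Area above a given height in terms of the L^p norm *)

(** Where [|u| <= h] the left side is nonpositive; where [|u| > h] the quotient [|u| / h] to the
    power [p - 1] is at least 1. *)
Lemma subr_le_powR (R : realType) (p h u w : R) : 1 < p -> 0 < h ->
  w <= `|u| -> w - h <= h `^ (1 - p) * `|u| `^ p.
Proof.
move=> p1 h0 wu; have [uh|hu] := leP `|u| h.
  by apply: (@le_trans _ _ 0); [lra|rewrite mulr_ge0// powR_ge0].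
have u0 : 0 < `|u| by exact: lt_trans hu.
apply: (@le_trans _ _ `|u|); first by lra.
have -> : `|u| `^ p = `|u| * `|u| `^ (p - 1) by rewrite mulr_powRB1//; lra.
rewrite mulrCA ler_peMr//.
have -> : 1 - p = - (p - 1) by ring.
rewrite powRN mulrC ler_pdivlMr ?powR_gt0// mul1r.
by apply: ge0_ler_powR; rewrite ?nnegrE ?ltW//; lra.
Qed.

(** [w] stands for the initial value and for its opposite. The pointwise bound is integrated over
    the segment, then its nonnegative right side over the whole line. *)
Lemma integral_superlevel_le (R : realType) (p h : R) (u w : R -> R) (z x : R) :
  1 < p -> 0 < h -> u \in Lfun (@lebesgue_measure R) p%:E ->
  continuous w -> (forall s, w s <= `|u s|) ->
  \int[lebesgue_measure]_(s in `[z, x]) (w s - h) <=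
    h `^ (1 - p) * lebesgue_Lp_norm p u `^ p.
Proof.
move=> p1 h0 /andP[uM uL] cw wu.
have mu : measurable_fun setT u by move: uM; rewrite inE.
have fu : ('N[@lebesgue_measure R]_(p%:E) [EFin \o u] < +oo)%E.
  by move: uL; rewrite inE.
have p0 : p != 0 by rewrite gt_eqF//; lra.
have mg : measurable_fun setT (fun s => `|u s| `^ p).
  apply: (@measurableT_comp _ _ _ _ _ _ (@powR R ^~ p)) => //.
  exact: measurableT_comp.
(* Membership in L^p makes the norm finite, so [fine] loses nothing. *)
have NE : (\int[lebesgue_measure]_s (`|u s| `^ p)%:E =
    (lebesgue_Lp_norm p u `^ p)%:E)%E.
  rewrite -poweR_EFin /lebesgue_Lp_norm fineK; last first.
    by rewrite fin_numElt fu andbT (lt_le_trans _ (Lnorm_ge0 _ _ _)).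
  by rewrite poweR_Lnorm.
have ig : (@lebesgue_measure R).-integrable setT
    (EFin \o (fun s => `|u s| `^ p)).
  apply/integrableP; split; first exact/measurable_EFinP.
  under eq_integral do rewrite /= ger0_norm ?powR_ge0//.
  by rewrite NE ltry.
have ig' : (@lebesgue_measure R).-integrable setT
    (EFin \o (fun s => h `^ (1 - p) * `|u s| `^ p)).
  rewrite (_ : _ \o _ = fun s => ((h `^ (1 - p))%:E * (`|u s| `^ p)%:E)%E)//.
  exact: integrableZl.
apply: (@le_trans _ _ (\int[lebesgue_measure]_(s in `[z, x])
    (h `^ (1 - p) * `|u s| `^ p))).
  apply: le_Rintegral => //.
  - apply: integrable_slice => s _.
    by apply: cvgB; [exact: cw|exact: cvg_cst].
  - exact: integrableS ig'.
  - by move=> s _; exact: subr_le_powR.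
apply: (@le_trans _ _ (\int[lebesgue_measure]_s (h `^ (1 - p) * `|u s| `^ p))).
  rewrite /Rintegral fine_le//.
  - by apply: integrable_fin_num => //; exact: integrableS ig'.
  - exact: integrable_fin_num.
  - apply: ge0_subset_integral => //; first by have /integrableP[] := ig'.
    by move=> s _; rewrite lee_fin mulr_ge0// powR_ge0.
by rewrite RintegralZl// /Rintegral NE.
Qed.

(** * Symmetries of the flow, and Ecker-Huisken solutions as flows *)

(** The arctangent is odd; this turns upper bounds into lower ones. *)
Lemma divergence_flowN (R : realType) (v vx vt : R -> R -> R) :
  divergence_flow v vx vt ->
  divergence_flow (fun x t => - v x t) (fun x t => - vx x t)
    (fun x t => - vt x t).
Proof.
move=> [cv dx dt flux cvt]; split.
- by move=> p; apply: cvgN; exact: cv.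
- by move=> x t t0; exact: is_deriveN (dx x t t0).
- by move=> x t t0; exact: is_deriveN (dt x t t0).
- move=> x t t0; have -> : (fun s => atan (- vx s t)) = - (fun s => atan (vx s t)).
    by apply/funext => s; rewrite !fctE atanN.
  exact: is_deriveN (flux x t t0).
- by move=> x t t0; apply: cvgN; exact: cvt.
Qed.

Lemma divergence_flowB (R : realType) (v vx vt : R -> R -> R) (h : R) :
  divergence_flow v vx vt -> divergence_flow (fun x t => v x t - h) vx vt.
Proof.
move=> [cv dx dt flux cvt]; split => //.
- by move=> p; apply: cvgB; [exact: cv|exact: cvg_cst].
- move=> x t t0.
  by apply: (is_derive_eq (is_deriveB (dx x t t0) (is_derive_cst h x 1))); ring.
- move=> x t t0.
  by apply: (is_derive_eq (is_deriveB (dt x t t0) (is_derive_cst h t 1))); ring.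
Qed.

(** Truncating the time extends [y] by its initial value to negative times: this gives continuity on
    the plane and changes nothing near a positive time. The flux identity is the chain rule for the
    arctangent. *)
Lemma ecker_huisken_flow (R : realType) (y0 : R -> R) (y : R -> R -> R) :
  is_ecker_huisken_solution y0 y ->
  divergence_flow (fun x t => y x (Num.max t 0)) (partial_x y) (partial_t y).
Proof.
move=> [cy sy eqy _ _].
have near_max (t : R) : 0 < t -> \forall s \near t, s = Num.max s 0.
  by move=> t0; near=> s; rewrite max_l// ltW//; near: s; exact: lt_nbhsr.
have smooth w (x t : R) (t0 : 0 < t) := sy w x t t0.
split.
- move=> p.
  have m0 (q : R * R) : 0 <= Num.max q.2 0 by rewrite le_max lexx orbT.
  have cp : (fun q : R * R => (q.1, Num.max q.2 0)) @ p --> (p.1, Num.max p.2 0).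
    exact: (cvg_pair cvg_fst
      (@continuous_max _ _ snd (fun=> 0 : R) p cvg_snd (cvg_cst _))).
  move/subspace_continuousP: cy => /(_ (p.1, Num.max p.2 0) (m0 p)) cyp A hA.
  exact: (@filterS _ (nbhs p) _ _ (fun q => A (y q.1 (Num.max q.2 0)))
    (fun q yq => yq (m0 q)) (cp _ (cyp A hA))).
- move=> x t t0; have [dx _ _] := smooth [::] x t t0.
  rewrite (_ : (fun _ => _) = y ^~ t); last by apply/funext => s; rewrite max_l// ltW.
  by apply: (DeriveDef dx); rewrite /partial_x derive1E.
- move=> x t t0; have [_ dt _] := smooth [::] x t t0.
  apply: (@near_eq_is_derive _ _ _ (y x)).
    by apply: filterS (near_max t t0) => s {1}->.
  by apply: (DeriveDef dt); rewrite /partial_t derive1E.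
- move=> x t t0; have [dxx _ _] := smooth [:: true] x t t0.
  have dx : is_derive x 1 ((partial_x y) ^~ t) (partial_x (partial_x y) x t).
    by apply: (DeriveDef dxx); rewrite /partial_x derive1E.
  apply: (is_derive_eq (is_derive1_comp (is_derive1_atan _) dx)).
  by rewrite eqy// mulrC.
- by move=> x t t0; have [_ _] := smooth [:: false] x t t0.
Unshelve. all: by end_near. Qed.

(** * Choice of the height, and the two-sided bound *)

Theorem theorem1p10 (R : realType) :
  exists C : R,
    forall (p : R) (y0 : R -> R) (y : R -> R -> R),
      1 < p ->
      locally_lipschitz y0 ->
      y0 \in Lfun (@lebesgue_measure R) p%:E ->
      is_ecker_huisken_solution y0 y ->
      forall x t : R,
        0 < t -> t < lebesgue_Lp_norm p y0 `^ (2 * p / (p + 1)) ->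
        `|y x t| <= C * t `^ (- (1 / (p - 1)))
                      * lebesgue_Lp_norm p y0 `^ (p / (p - 1)).
Proof.
(* The constant is 8 + 1: [8 * r] above the height [h], with [r <= h]. *)
exists 9 => p y0 y p1 _ y0L ehy x t t0.
set N := lebesgue_Lp_norm p y0 => tN.
have p0 : 0 < p by lra.
have p10 : 0 < p - 1 by lra.
have Nge0 : 0 <= N by rewrite fine_ge0// Lnorm_ge0.
(* If [N] vanished, so would its power, the exponent being nonzero, and no time would be
   admissible. *)
have N0 : 0 < N.
  rewrite lt_neqAle Nge0 andbT; apply/eqP => NE; move: tN.
  rewrite -NE powR0; first by rewrite ltNge (ltW t0).
  by rewrite gt_eqF// divr_gt0//; lra.
pose h := t `^ (- (1 / (p - 1))) * N `^ (p / (p - 1)).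
have h0 : 0 < h by rewrite mulr_gt0// powR_gt0.
have hN : h `^ (1 - p) * N `^ p = t.
  rewrite powRM ?powR_ge0// -!powRrM.
  have -> : - (1 / (p - 1)) * (1 - p) = 1 by field; lra.
  have -> : p / (p - 1) * (1 - p) = - p by field; lra.
  by rewrite powRr1 ?ltW// powRN -mulrA mulVf ?mulr1// gt_eqF// powR_gt0.
pose r := Num.sqrt t.
have r0 : 0 < r by rewrite sqrtr_gt0.
have rt : r ^+ 2 = t by rewrite sqr_sqrtr// ltW.
have rh : r <= h.
  (* Raised to this exponent, the restriction on [t] bounds [t] to the power 1/2 + 1/(p-1) by [N] to
     the power p/(p-1). *)
  have e0 : 0 <= (p + 1) / (2 * (p - 1)) by rewrite divr_ge0; lra.
  have := ge0_ler_powR e0 (ltW t0) (powR_ge0 N (2 * p / (p + 1))) (ltW tN).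
  rewrite -powRrM.
  have -> : 2 * p / (p + 1) * ((p + 1) / (2 * (p - 1))) = p / (p - 1).
    by field; apply/andP; split; lra.
  have -> : (p + 1) / (2 * (p - 1)) = 2^-1 + 1 / (p - 1) by field; lra.
  rewrite powRD; last by rewrite (gt_eqF t0) implybT.
  rewrite powR12_sqrt ?(ltW t0)// -/r => rN.
  by rewrite /h powRN mulrC ler_pdivlMr// powR_gt0.
have fl := ecker_huisken_flow ehy.
(* Stated for a general flow so as to serve both [y] and its opposite. *)
have main v vx vt : divergence_flow v vx vt -> (forall s, v s 0 <= `|y0 s|) ->
    v x t <= 9 * h.
  move=> flv vy.
  have : v x (r ^+ 2) - h <= 8 * r.
    apply: (flow_le x (divergence_flowB h flv) r0) => z z' _.
    rewrite rt -hN; apply: integral_superlevel_le => // s.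
    exact/continuous_slice1/(flow_cont flv).
  rewrite rt; lra.
have maxt : Num.max t 0 = t by rewrite max_l// ltW.
rewrite -mulrA -/h ler_norml; apply/andP; split.
- rewrite lerNl; have := main _ _ _ (divergence_flowN fl).
  rewrite maxxx maxt; apply => s.
  by rewrite (eh_initial ehy) -normrN ler_norm.
- have := main _ _ _ fl; rewrite maxxx maxt; apply => s.
  by rewrite (eh_initial ehy) ler_norm.
Qed.
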